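(* Let $D$ be a regular $(v,k,\lambda,\mu)$-PDS in a finite group $G$ with $0<\mu<k$ and $\sqrt\Delta\in\mathbb{Z}$. Let $H$ be a nontrivial subgroup of the group of linear characters of $G$ all of whose elements have order coprime to $\sqrt\Delta$, and let $N=\bigcap_{\xi\in H}\ker\xi$. Then for every $a\in G\setminus N$ and every nonprincipal $\xi\in H$, \[|C_G(a)|\cdot|a^G\cap D|=k-\xi(D).\]
   Context: A $(v,k,\lambda,\mu)$-PDS in a group $G$ of order $v$ is a $k$-subset $D$ such that every nonidentity element of $D$ is $xy^{-1}$ ($x,y\in D$) in exactly $\lambda$ ways and every nonidentity element of $G\setminus D$ in exactly $\mu$ ways; regular means $D=D^{(-1)}$ and $1\notin D$. $\Delta=(\lambda-\mu)^2+4(k-\mu)$; $\chi(D)=\sum_{d\in D}\chi(d)$; $a^G$ is the conjugacy class of $a$. *)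

(* Defs.v *)
From mathcomp Require Import all_boot all_order all_algebra all_fingroup all_solvable all_field all_character.
Set Implicit Arguments. Unset Strict Implicit. Unset Printing Implicit Defensive.
Import GRing.Theory Num.Theory.
Local Open Scope group_scope.

Definition is_PDS (gT : finGroupType) (G : {group gT}) (D : {set gT})
    (v k lam mu : nat) : Prop :=
  [/\ D \subset G, #|G| = v, #|D| = k &
      forall g, g \in G -> g != 1 ->
        #|[set p in setX D D | p.1 * p.2^-1 == g]| = (if g \in D then lam else mu)].

Definition is_regular_PDS (gT : finGroupType) (G : {group gT}) (D : {set gT})
    (v k lam mu : nat) : Prop :=
  [/\ is_PDS G D v k lam mu, D^-1 = D & 1 \notin D].

Definition PDS_Delta (k lam mu : nat) : int :=
  ((lam%:Z - mu%:Z) ^+ 2 + 4 * (k%:Z - mu%:Z))%R.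

Definition is_lin_char_subgroup (gT : finGroupType) (G : {group gT})
    (H : {set Iirr G}) : Prop :=
  [/\ forall i, i \in H -> 'chi_i \is a linear_char,
      (0 : Iirr G) \in H,
      forall i j, i \in H -> j \in H ->
        exists2 l, l \in H & 'chi_l = 'chi_i * 'chi_j &
      forall i, i \in H -> exists2 l, l \in H & 'chi_l = ('chi_i)^-1]%R.

(* Main.v *)
Require Import Defs.
From mathcomp Require Import all_boot all_order all_algebra all_fingroup all_solvable all_field all_character.
From mathcomp Require Import zify ring.
Import GRing.Theory Num.Theory.
Local Open Scope ring_scope.
Set Implicit Arguments. Unset Strict Implicit. Unset Printing Implicit Defensive.

(** Let xi in H have order dividing p^e, with p prime and xi(a) <> 1, and put
    q = p^n.  Cyclic rotation acts on the q-tuples of elements of D whose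
    product lies in a^G; as xi(a) is not 1, no such tuple has a short orbit, so
    their number is divisible by p^(n-e).  On the other hand, in the group
    ring D^q = alpha + beta D + gamma G with theta^q = alpha + beta theta for
    each root theta of X^2 = (lam - mu) X + (k - mu).  With theta = xi(D) and
    F = |C_G(a)| |a^G :&: D|, this says
      beta (F - k + theta) + (k^q - theta^q) = 0  (mod p^(n-e)).
    Since theta = k (mod p), the second term vanishes modulo p^(n+1), and beta is
    prime to p because p does not divide the difference +-s of the two roots.
    Letting n grow gives F = k - xi(D).

    Moreover xi(D) is the same for all nonprincipal xi in H: multiplying xi by a
    character of p-power order does not change xi(D) modulo p, and the two
    possible values of xi(D) differ modulo p. *)

(** * Integer congruences modulo powers of a prime *)

Lemma dvdz_sub_exp (d x y : int) n : (d %| x - y)%Z -> (d %| x ^+ n - y ^+ n)%Z.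
Proof. by move=> dxy; rewrite subrXX dvdz_mulr. Qed.

(** The cofactor of [x - y] in [x ^+ p - y ^+ p] is a sum of [p] terms, each congruent to
    [y ^+ p.-1] modulo [p]; it supplies the extra factor [p]. *)
Lemma dvdz_sub_exp_prime (p m : nat) (x y : int) :
  (0 < m)%N -> (p%:Z ^+ m %| x - y)%Z -> (p%:Z ^+ m.+1 %| x ^+ p - y ^+ p)%Z.
Proof.
move=> m_gt0 dxy; rewrite subrXX exprSr dvdz_mul //.
have dp: (p%:Z %| x - y)%Z.
  exact: dvdz_trans (dvdz_exp m_gt0 (dvdzz _)) dxy.
have ->: \sum_(i < p) x ^+ (p.-1 - i) * y ^+ i
  = \sum_(i < p) (x ^+ (p.-1 - i) - y ^+ (p.-1 - i)) * y ^+ i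
    + p%:Z * y ^+ p.-1.
  rewrite -[p%:Z]natz mulr_natl -[X in _ *+ X]card_ord -sumr_const -big_split /=.
  apply: eq_bigr => i _; rewrite mulrBl -exprD subnK ?subrK //.
  by have := ltn_ord i; lia.
rewrite rpredD ?dvdz_mulr //; apply: rpred_sum => i _.
by rewrite dvdz_mulr // dvdz_sub_exp.
Qed.

Lemma dvdz_sub_exp_primepow (p n : nat) (x y : int) :
  (p%:Z %| x - y)%Z -> (p%:Z ^+ n.+1 %| x ^+ (p ^ n) - y ^+ (p ^ n))%Z.
Proof.
move=> dxy; elim: n => [|n IHn]; first by rewrite expn0 !expr1.
by rewrite expnSr !exprM dvdz_sub_exp_prime.
Qed.

Lemma fermat_little_int (p n : nat) (x : int) :
  prime p -> (p%:Z %| x ^+ (p ^ n) - x)%Z.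
Proof.
move=> p_pr; elim: n => [|n IHn]; first by rewrite expn0 expr1 subrr dvdz0.
rewrite expnSr exprM -(subrK (x ^+ p) ((_ ^+ _) ^+ p)) -addrA rpredD ?dvdz_sub_exp //.
(* [fermat_little] concerns natural numbers, so [x] is traded for its residue. *)
pose r := `|(x %% p)%Z|%N.
have er : x %% p = r%:Z :> int.
  by rewrite gez0_abs // modz_ge0 // eqz_nat -lt0n prime_gt0.
have dxr : (p%:Z %| x - r%:Z)%Z.
  by rewrite -er {1}(divz_eq x p) addrK dvdz_mull.
have: (p%:Z %| r%:Z ^+ p - r%:Z)%Z.
  by rewrite -eqz_mod_dvd -rmorphXn /= !modz_nat eqz_nat natrXE fermat_little.
have := dvdz_sub_exp p dxr => d1 d2.
have ->: x ^+ p - x = (x ^+ p - r%:Z ^+ p) + (r%:Z ^+ p - r%:Z) - (x - r%:Z) by ring.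
by rewrite rpredB // rpredD.
Qed.

Lemma eq_primepow_dvd0 (p : nat) (x : int) :
  prime p -> (forall n, (p%:Z ^+ n %| x)%Z) -> x = 0.
Proof.
(* The exponent [|x|] suffices, since [p ^ |x|] exceeds [|x|]. *)
move=> p_pr /(_ `|x|%N); rewrite dvdzE abszX absz_nat => dx.
apply/eqP; rewrite -absz_eq0; apply/negPn/negP; rewrite -lt0n => x_gt0.
by have := dvdn_leq x_gt0 dx; rewrite leqNgt ltn_expl ?prime_gt1.
Qed.

(** * Words over [D] and their cyclic rotation *)

Section Rotation.
Variables (gT : finGroupType) (n : nat).

Definition words (D : {set gT}) := [set t : n.-tuple gT | all (mem D) t].

Lemma rot_tuple_inj : injective (fun t : n.-tuple gT => [tuple of seq.rot 1 t]).
Proof. by move=> t u /(congr1 val) /rot_inj /val_inj. Qed.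

Definition word_rot : {perm n.-tuple gT} := perm rot_tuple_inj.

Lemma word_rotX k (t : n.-tuple gT) :
  (k <= n)%N -> tval ((word_rot ^+ k)%g t) = seq.rot k t.
Proof.
elim: k => [|k IHk] le_kn; first by rewrite expg0 perm1 rot0.
by rewrite expgSr permM permE /= IHk ?(ltnW le_kn) // -rotS ?size_tuple.
Qed.

Lemma word_rot_order : (word_rot ^+ n = 1)%g.
Proof.
apply/permP=> t; apply: val_inj; rewrite /= word_rotX // perm1.
by rewrite -{1}(size_tuple t) rot_size.
Qed.
End Rotation.

(** Commuting with [a] forces [b] to be [a] repeated [c] times: [a] is a prefix of [b], and what
    remains of [b] still commutes with [a]. *)
Lemma prod_cat_comm (T : eqType) (R : comPzRingType) (f : T -> R) c (a b : seq T) :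
  a ++ b = b ++ a -> size b = (size a * c)%N ->
  \prod_(x <- a ++ b) f x = (\prod_(x <- a) f x) ^+ c.+1.
Proof.
elim: c b => [|c IHc] b eab sb.
  have -> : b = [::] by apply/size0nil; rewrite sb muln0.
  by rewrite cats0 expr1.
have sab : (size a <= size b)%N by rewrite sb mulnS leq_addr.
have eb : b = a ++ drop (size a) b.
  rewrite -{1}(cat_take_drop (size a) b); congr (_ ++ _).
  by move/(congr1 (take (size a))): eab; rewrite take_size_cat // takel_cat.
rewrite big_cat exprS {1}eb /= (IHc (drop (size a) b)) ?size_drop ?sb ?mulnS ?addKn //.
by move: eab; rewrite eb -catA drop_size_cat // => /(congr1 (drop (size a))); rewrite !drop_size_cat.
Qed.

Lemma rot_prodX (T : eqType) (R : comPzRingType) (f : T -> R) m c (t : seq T) :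
  seq.rot m t = t -> size t = (m * c.+1)%N ->
  \prod_(x <- t) f x = (\prod_(x <- take m t) f x) ^+ c.+1.
Proof.
move=> rt st; rewrite -{1}(cat_take_drop m t).
have sm : size (take m t) = m by rewrite size_takel // st leq_pmulr.
apply: prod_cat_comm; first by rewrite cat_take_drop -[RHS]/(seq.rot m t) rt.
by rewrite size_drop sm st mulnS addKn.
Qed.

(** * Words whose product lies in a given conjugacy class *)

Section WordCount.
Variables (gT : finGroupType) (G : {group gT}) (D : {set gT}).
Hypothesis sDG : D \subset G.

Lemma lin_char_word (xi : 'CF(G)) n (t : n.-tuple gT) : xi \is a linear_char ->
  t \in words n D -> xi (\prod_(x <- t) x)%g = \prod_(x <- t) xi x.
Proof.
rewrite inE => Lxi /allP Dt; rewrite !big_seq lin_char_prod // => x /Dt.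
exact: (subsetP sDG).
Qed.

Definition class_words n (a : gT) :=
  [set t in words n D | (\prod_(x <- t) x)%g \in (a ^: G)%g].

(* Rotation acts on the words of length p^n spelling an element of a^G. On a
   word with orbit size p^j, the product of the [xi]-values is a p^(n-j)-th
   power of a value of [xi], so it can differ from 1 only if n - j < e. *)
Lemma dvdn_card_class_words (xi : 'CF(G)) p e n a :
  prime p -> xi \is a linear_char -> xi ^+ (p ^ e) = 1 ->
  a \in G -> xi a != 1 -> (p ^ (n - e) %| #|class_words (p ^ n) a|)%N.
Proof.
move=> p_pr Lxi xi1 Ga xia1; set q := (p ^ n)%N; set s := word_rot gT q.
have actS : [acts <[s]>%g, on class_words q a | 'P].
  rewrite cycle_subG; apply/astabsP => t /=.
  rewrite apermE !inE permE /=.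
  (* Moving the first letter [x] to the end conjugates the product by [x], so it stays in the
     class. *)
  case: (tval t) => // x u; rewrite rot1_cons all_rcons big_rcons big_cons /=.
  apply: andb_id2l => /andP[/(subsetP sDG) Gx _].
  rewrite -[RHS](memJ_norm _ (subsetP (class_norm a G) x Gx)).
  by rewrite conjgE -mulgA mulKg.
rewrite -(acts_sum_card_orbit actS); apply: dvdn_sum => O /imsetP[t St ->].
have /dvdn_pfactor-/(_ p_pr)[j le_jn oj] : (#|orbit 'P <[s]>%g t| %| p ^ n)%N.
  apply: dvdn_trans (dvdn_orbit _ _ _) _.
  by rewrite order_dvdn; apply/eqP; apply: word_rot_order.
have {}oj : #|porbit s t| = (p ^ j)%N by rewrite -oj porbitE.
rewrite -porbitE oj; apply: dvdn_exp2l; rewrite leqNgt; apply/negP => lt_j.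
have rt : seq.rot (p ^ j) t = t.
  rewrite -word_rotX ?leq_exp2l ?prime_gt1 // -oj permX; congr (tval _).
  exact: iter_porbit.
have le_e : (e <= n - j)%N by lia.
have st : size t = (p ^ j * (p ^ (n - j)).-1.+1)%N.
  by rewrite size_tuple prednK ?expn_gt0 ?prime_gt0 // -expnD subnKC.
move: St; rewrite inE => /andP[Wt]; rewrite class_sym => /imsetP[b Gb ab].
case/eqP: xia1; rewrite ab cfunJ // (lin_char_word Lxi Wt) (rot_prodX _ rt st).
rewrite prednK ?expn_gt0 ?prime_gt0 // -(subnKC le_e) expnD exprM -prodrXl.
rewrite big1_seq ?expr1n // => x /andP[_ /mem_take tx].
move: Wt; rewrite inE => /allP/(_ _ tx)/(subsetP sDG) Gx.
by rewrite -exp_cfunE // xi1 cfun1E Gx.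
Qed.
End WordCount.

(** * Sums over words, by splitting off the first letter *)

Lemma sum_words_recl (gT : finGroupType) (R : nmodType) (D : {set gT}) n (f : gT -> R) :
  \sum_(t in words n.+1 D) f (\prod_(x <- t) x)%g =
  \sum_(d in D) \sum_(t in words n D) f (d * \prod_(x <- t) x)%g.
Proof.
rewrite pair_big /= (reindex (fun p : gT * n.-tuple gT => cons_tuple p.1 p.2)) /=.
  by apply: eq_big => [[x t]|[x t] _]; rewrite ?inE //= big_cons.
exists (fun t : n.+1.-tuple gT => (thead t, behead_tuple t)) => [[x t] _|t _].
  by congr (_, _); apply: val_inj.
by rewrite [t in RHS]tuple_eta; apply: val_inj.
Qed.

Lemma sum_words0 (gT : finGroupType) (R : nmodType) (D : {set gT}) (f : gT -> R) :
  \sum_(t in words 0 D) f (\prod_(x <- t) x)%g = f 1%g.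
Proof.
rewrite (big_pred1 [tuple]) ?big_nil // => t.
by rewrite !inE [t]tuple0 /= eqxx.
Qed.

Lemma card_words (gT : finGroupType) n (D : {set gT}) : #|words n D| = (#|D| ^ n)%N.
Proof.
elim: n => [|n IHn]; first by rewrite -sum1_card; apply: (sum_words0 D (fun=> 1%N)).
rewrite -sum1_card (sum_words_recl D n (fun=> 1%N)); under eq_bigr do rewrite sum1_card IHn.
by rewrite sum_nat_const expnS.
Qed.

(** * Powers of [D] in the group ring *)

Section PDS.
Variables (gT : finGroupType) (G : {group gT}) (D : {set gT}).
Variables (v k lam mu : nat).
Hypothesis pdsD : is_regular_PDS G D v k lam mu.

Lemma PDS_sub : D \subset G. Proof. by case: pdsD => [[]]. Qed.

(** This is the group ring identity D^2 = (k - mu) + (lam - mu) D + mu G, tested against an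
    arbitrary [f]. Since [D] is closed under inversion, products of pairs may be read as
    quotients. *)
Lemma PDS_sum_pairs (R : pzRingType) (f : gT -> R) :
  \sum_(d in D) \sum_(d' in D) f (d * d')%g =
  (k%:R - mu%:R) * f 1%g + (lam%:R - mu%:R) * \sum_(d in D) f d
  + mu%:R * \sum_(g in G) f g.
Proof.
have [[sDG _ kD cD] DV D1] := pdsD.
transitivity (\sum_(g in G) \sum_(p in setX D D | (p.1 * p.2^-1)%g == g) f g).
  transitivity (\sum_(d in D) \sum_(d' in D) f (d * d'^-1)%g).
    apply: eq_bigr => d _; rewrite [LHS](reindex_inj invg_inj) /=.
    by apply: eq_bigl => x; rewrite -{1}DV memV_invg.
  rewrite pair_big /= (partition_big (fun p => (p.1 * p.2^-1)%g) [in G]) /=.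
    apply: eq_bigr => g _; apply: eq_big => [[x y]|[x y] /andP[_ /eqP ->]] //=.
    by rewrite inE.
  move=> [x y] /= /andP[/(subsetP sDG) Gx /(subsetP sDG) Gy].
  by rewrite groupM ?groupV.
have sumE g : \sum_(p in setX D D | (p.1 * p.2^-1)%g == g) f g =
    #|[set p in setX D D | (p.1 * p.2^-1)%g == g]|%:R * f g.
  by rewrite mulr_natl -sumr_const; apply: eq_bigl => p; rewrite !inE.
rewrite (eq_bigr _ (fun g _ => sumE g)) (bigD1 1%g) //=.
(* The identity is the quotient of exactly the [k] diagonal pairs. *)
have -> : #|[set p in setX D D | (p.1 * p.2^-1)%g == 1%g]| = k.
  rewrite -kD -(card_imset [in D] (f := fun x => (x, x))); last by move=> x y [].
  apply: eq_card => -[x y]; rewrite !inE /= -eq_mulgV1.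
  apply/andP/imsetP => [[/andP[Dx _] /eqP <-]|[z Dz [-> ->]]]; first by exists x.
  by rewrite Dz eqxx.
rewrite [\sum_(g in G) f g](bigD1 1%g) //= mulrDr.
have -> : \sum_(d in D) f d = \sum_(g in G | g != 1%g) (g \in D)%:R * f g.
  rewrite big_mkcond [RHS]big_mkcond /=; apply: eq_bigr => g _.
  have [Dg|D'g] := boolP (g \in D); last by rewrite mul0r if_same.
  by rewrite (subsetP sDG) // mul1r ifT //; apply: contraNneq D1 => <-.
rewrite addrACA -mulrDl subrK; congr (_ + _).
rewrite !mulr_sumr -big_split; apply: eq_bigr => g /andP[Gg g1] /=.
rewrite cD //; case: ifP => _; rewrite ?mul1r ?mul0r ?mulr0 ?add0r //.
by rewrite -mulrDl subrK.
Qed.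

Lemma PDS_sum_words n : exists alpha beta gamma : int,
  [/\ forall f : gT -> int, \sum_(t in words n D) f (\prod_(x <- t) x)%g =
        alpha * f 1%g + beta * \sum_(d in D) f d + gamma * \sum_(g in G) f g &
      forall th : int, th ^+ 2 = (lam%:R - mu%:R) * th + (k%:R - mu%:R) ->
        th ^+ n = alpha + beta * th].
Proof.
elim: n => [|n [al [be [ga [IHf IHth]]]]].
  exists 1, 0, 0; split=> [f|th _]; last by rewrite mul0r addr0.
  by rewrite sum_words0 !mul0r !addr0 mul1r.
(* Multiply alpha + beta D + gamma G by D, then use the formula for D^2 and D G = k G. *)
exists (be * (k%:R - mu%:R)), (al + be * (lam%:R - mu%:R)), (be * mu%:R + ga * k%:R).
split=> [f|th eth]; last first.
  by rewrite exprS IHth // mulrDr mulrCA -expr2 eth; ring.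
rewrite sum_words_recl; under eq_bigr do rewrite (IHf (fun x => f (_ * x)%g)) mulg1.
rewrite !big_split /= -!mulr_sumr PDS_sum_pairs.
have -> : \sum_(d in D) \sum_(g in G) f (d * g)%g = k%:R * \sum_(g in G) f g.
  have [[sDG _ <- _] _ _] := pdsD.
  rewrite mulr_natl -sumr_const; apply: eq_bigr => d /(subsetP sDG) Gd.
  by rewrite [RHS](reindex_inj (mulgI d)) /=; apply: eq_bigl => g; rewrite groupMl.
ring.
Qed.

Local Notation F a := (#|'C_G[a]%g| * #|((a ^: G) :&: D)%g|)%N.

(** Test the expansion of D^n against the indicator of the class of [a], which misses 1, and against
    the constant 1. Since |C_G(a)| |a^G| = v, gamma cancels between the two; alpha is then th^n -
    beta th. The last clause, by which beta is later shown prime to p, subtracts this relation for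
    the two roots. *)
Lemma PDS_card_class_words n a : a \in G -> a != 1%g ->
  exists2 be : int,
    forall th : int, th ^+ 2 = (lam%:R - mu%:R) * th + (k%:R - mu%:R) ->
      (#|'C_G[a]%g| * #|class_words G D n a|)%N%:R =
        be * ((F a)%:R - k%:R + th) + (k%:R ^+ n - th ^+ n) &
    forall th1 th2 : int, th1 + th2 = lam%:R - mu%:R -> th1 * th2 = mu%:R - k%:R ->
      be * (th1 - th2) = th1 ^+ n - th2 ^+ n.
Proof.
move=> Ga a1; have [al' [be' [ga [sumf powth]]]] := PDS_sum_words n.
have [[sDG vG kD cD] DV D1] := pdsD.
have root th1 th2 : th1 + th2 = lam%:R - mu%:R -> th1 * th2 = mu%:R - k%:R ->
   th1 ^+ 2 = (lam%:R - mu%:R) * th1 + (k%:R - mu%:R) :> int.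
  by move=> <- e; rewrite -[k%:R - _]opprB -e; ring.
exists be' => [th eth|t1 t2 e1 e2]; last first.
  rewrite (powth t1) ?(powth t2) ?(root t1 t2) ?(root t2 t1) //; first ring.
  - by rewrite addrC.
  - by rewrite mulrC.
have := sumf (fun _ => 1); have := sumf (fun x => (x \in (a ^: G)%g)%:R).
have cardE (S : {set gT}) : \sum_(x in S) (x \in (a ^: G)%g)%:R = #|(a ^: G) :&: S|%g%:R :> int.
  rewrite -sum1_card natr_sum big_mkcond [RHS]big_mkcond; apply: eq_bigr => x _.
  by rewrite inE; case: (x \in S); case: (x \in (a ^: G)%g).
have -> : \sum_(t in words n D) ((\prod_(x <- t) x)%g \in (a ^: G)%g)%:R
    = #|class_words G D n a|%:R :> int.
  rewrite -sum1_card natr_sum big_mkcond [RHS]big_mkcond; apply: eq_bigr => t _.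
  by rewrite [in RHS]inE; case: (t \in _); case: (_ \in _).
have -> : (1%g \in (a ^: G)%g) = false.
  by apply: contraNF a1 => /class_eqP; rewrite class1G => e; have := class_refl G a; rewrite -e => /set1P ->.
rewrite !cardE !sumr_const card_words kD vG (setIidPl (class_subG Ga (subxx G))) natrX => sC sT.
have cC : (#|'C_G[a]%g|%:R * #|(a ^: G)%g|%:R = v%:R :> int).
  by rewrite -natrM -index_cent1 -vG Lagrange ?subsetIl.
rewrite !natrM sC !mulr0 add0r sT (powth th eth) -cC; ring.
Qed.

End PDS.

(** * The Frobenius congruence for algebraic integers *)

Lemma eqAmod_exprD_prime p (x y : algC) : prime p -> x \in Aint -> y \in Aint ->
  ((x + y) ^+ p == x ^+ p + y ^+ p %[mod p%:R])%A.
Proof.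
move=> p_pr Zx Zy; have p_gt0 := prime_gt0 p_pr.
rewrite exprDn -(prednK p_gt0) big_ord_recr big_ord_recl /= prednK //.
rewrite subn0 subnn bin0 binn !expr0 mulr1 mul1r !mulr1n addrAC /eqAmod [_ - _]addrC addKr.
apply: rpred_sum => i _; rewrite -mulr_natl -eqAmod0.
have /dvdnP[c ->] : (p %| 'C(p, lift ord0 i))%N.
  by rewrite prime_dvd_bin //= /bump /=; have := ltn_ord i; lia.
by rewrite natrM -mulrA mulrCA eqAmodMr0 // !rpredM ?rpredX ?rpred_nat.
Qed.

Lemma eqAmodX e n (x y : algC) : x \in Aint -> y \in Aint ->
  (x == y %[mod e])%A -> (x ^+ n == y ^+ n %[mod e])%A.
Proof.
move=> Zx Zy exy; elim: n => [|n IHn]; first by rewrite !expr0.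
by rewrite !exprS eqAmodM ?rpredX.
Qed.

Lemma eqAmod_expr_sum_primepow p n (I : finType) (A : {set I}) (f : I -> algC) :
  prime p -> (forall i, i \in A -> f i \in Aint) ->
  ((\sum_(i in A) f i) ^+ (p ^ n) == \sum_(i in A) f i ^+ (p ^ n) %[mod p%:R])%A.
Proof.
move=> p_pr Zf; elim: n => [|n IHn]; first by rewrite expn0 expr1.
rewrite expnSr exprM; set S := \sum_(i in A) _ in IHn *.
have Zfn i : i \in A -> f i ^+ (p ^ n) \in Aint by move=> Ai; rewrite rpredX ?Zf.
apply: eqAmod_trans (eqAmodX _ _ _ IHn) _; rewrite ?rpredX ?rpred_sum //.
under [X in eqAmod _ _ X]eq_bigr do rewrite exprM.
(* Integrality of the partial sums is carried along, as the binomial congruence requires it. *)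
pose K (x y : algC) := (x \in Aint) && (x ^+ p == y %[mod p%:R])%A.
suff: K (\sum_(i in A) f i ^+ (p ^ n)) (\sum_(i in A) (f i ^+ (p ^ n)) ^+ p).
  by case/andP.
apply: (big_rec2 K) => [|i y x Ai /andP[Zx eq_x]]; rewrite /K.
  by rewrite rpred0 expr0n gtn_eqF ?prime_gt0 /=.
rewrite rpredD ?Zfn //= (eqAmod_trans (eqAmod_exprD_prime p_pr _ _)) ?Zfn //.
by rewrite eqAmodDl.
Qed.

(** * Values of linear characters on [D] *)

Lemma sum_lin_char_eq0 (gT : finGroupType) (G : {group gT}) (xi : 'CF(G)) :
  xi \is a linear_char -> xi != 1 -> \sum_(g in G) xi g = 0.
Proof.
move=> Lxi nt_xi; have [g Gg xig] : exists2 g, g \in G & xi g != 1.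
  apply/exists_inP; apply: contraNT nt_xi => /exists_inPn xi1.
  by apply/eqP/cfun_inP => g Gg; rewrite cfun1E Gg; apply/eqP; have := xi1 g Gg; rewrite negbK.
have/eqP : \sum_(g in G) xi g = xi g * \sum_(g in G) xi g.
  rewrite mulr_sumr [LHS](reindex_inj (mulgI g)) /=.
  by apply: eq_big => [h|h]; rewrite groupMl // => Gh; rewrite lin_charM.
by rewrite -subr_eq0 -{1}[\sum_(g in G) _]mul1r -mulrBl mulf_eq0 subr_eq0 eq_sym (negbTE xig) => /eqP.
Qed.

Section PDSLinearCharacters.
Variables (gT : finGroupType) (G : {group gT}) (D : {set gT}).
Variables (v k lam mu s : nat).
Hypothesis pdsD : is_regular_PDS G D v k lam mu.
Hypothesis sqrt_Delta : (s%:Z ^+ 2)%R = PDS_Delta k lam mu.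

Let sDG := PDS_sub pdsD.

Lemma PDS_lin_char_quadratic (xi : 'CF(G)) : xi \is a linear_char -> xi != 1 ->
  (\sum_(d in D) xi d) ^+ 2 =
    (lam%:R - mu%:R) * (\sum_(d in D) xi d) + (k%:R - mu%:R).
Proof.
move=> Lxi nt_xi.
transitivity (\sum_(d in D) \sum_(d' in D) xi (d * d')%g).
  rewrite expr2 mulr_suml; apply: eq_bigr => d /(subsetP sDG) Gd.
  rewrite mulr_sumr; apply: eq_bigr => d' /(subsetP sDG) Gd'.
  by rewrite lin_charM.
by rewrite (PDS_sum_pairs pdsD) sum_lin_char_eq0 // lin_char1 // mulr0 addr0 mulr1 addrC.
Qed.

(** Completing the square gives (2 X - (lam - mu))^2 = Delta = s^2, so the algebraic integer X =
    xi(D) is rational, hence an integer. *)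
Lemma PDS_lin_char_int (xi : 'CF(G)) : xi \is a linear_char -> xi != 1 ->
  exists2 th : int, \sum_(d in D) xi d = th%:~R &
    th ^+ 2 = (lam%:R - mu%:R) * th + (k%:R - mu%:R).
Proof.
move=> Lxi nt_xi; have quad := PDS_lin_char_quadratic Lxi nt_xi.
set X := \sum_(d in D) xi d in quad *.
have ZX : X \in Aint by rewrite rpred_sum // => d _; rewrite Aint_char ?lin_charW.
have sqr : (2 * X - (lam%:R - mu%:R)) ^+ 2 = s%:R ^+ 2.
  have /(congr1 (fun z : int => z%:~R : algC)) := sqrt_Delta.
  rewrite /PDS_Delta rmorphXn rmorphD rmorphM rmorphXn !rmorphB /= => ->.
  have -> : (2 * X - (lam%:R - mu%:R)) ^+ 2 =
    4 * X ^+ 2 - 4 * (lam%:R - mu%:R) * X + (lam%:R - mu%:R) ^+ 2 by ring.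
  by rewrite quad; ring.
have QX : X \in Crat.
  have -> : X = ((2 * X - (lam%:R - mu%:R)) + (lam%:R - mu%:R)) / 2 by field.
  rewrite rpred_div ?rpred_nat // rpredD //; last by rewrite rpredB ?rpred_nat.
  by move/eqP: sqr; rewrite eqf_sqr => /orP[]/eqP->; rewrite ?rpredN rpred_nat.
have /intrP[th Xth] := Cint_rat_Aint QX ZX.
exists th => //; apply/eqP; rewrite -(eqr_int algC).
by rewrite rmorphXn rmorphD rmorphM !rmorphB /= -Xth !rmorph_nat quad.
Qed.

(** Raising to the power p^e commutes with the sum over [D] modulo [p] and erases [ze]; Fermat's
    little theorem then removes the exponent. *)
Lemma PDS_lin_char_congr p e (al ze : 'CF(G)) (th th' : int) :
  prime p -> al \is a linear_char -> ze \is a linear_char -> ze ^+ (p ^ e) = 1 ->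
  \sum_(d in D) al d = th%:~R -> \sum_(d in D) (al * ze) d = th'%:~R ->
  (p%:Z %| th - th')%Z.
Proof.
move=> p_pr Lal Lze ze1 al_th alze_th'.
have Zc (xi : 'CF(G)) d : xi \is a linear_char -> d \in D -> xi d \in Aint.
  by move=> Lxi _; rewrite Aint_char ?lin_charW.
have E1 := eqAmod_expr_sum_primepow e p_pr (fun d => Zc al d Lal).
have E2 := eqAmod_expr_sum_primepow e p_pr (fun d => Zc (al * ze) d (rpredM Lal Lze)).
have eqS : \sum_(d in D) (al * ze) d ^+ (p ^ e) = \sum_(d in D) al d ^+ (p ^ e).
  apply: eq_bigr => d /(subsetP sDG) Gd.
  by rewrite cfunE exprMn -[ze d ^+ _]exp_cfunE // ze1 cfun1E Gd mulr1.
have {E1 E2} : (p%:Z %| th ^+ (p ^ e) - th' ^+ (p ^ e))%Z.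
  rewrite eqS eqAmod_sym in E2; have := eqAmod_trans E1 E2.
  rewrite al_th alze_th' /eqAmod -!rmorphXn -rmorphB /= -eqAmod0.
  (* Between rational integers, a congruence in the algebraic integers is divisibility in Z. *)
  rewrite eqAmod0_rat ?rpred_nat ?rpred_int // => dC.
  have : (p %| (th ^+ (p ^ e) - th' ^+ (p ^ e))%:~R)%C := dC.
  by rewrite dvdC_int ?rpred_int // intrKfloor dvdzE.
have := fermat_little_int e th p_pr; have := fermat_little_int e th' p_pr.
move=> d' d dq.
have -> : th - th' = th ^+ (p ^ e) - th' ^+ (p ^ e)
   - (th ^+ (p ^ e) - th) + (th' ^+ (p ^ e) - th') by ring.
by rewrite rpredD // rpredB.
Qed.

(** Two distinct roots would be all the roots of the quadratic, so their difference would have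
    square Delta = s^2, which is prime to [p]. *)
Lemma PDS_roots_congr p (th th' : int) : prime p -> coprime p s ->
  th ^+ 2 = (lam%:R - mu%:R) * th + (k%:R - mu%:R) ->
  th' ^+ 2 = (lam%:R - mu%:R) * th' + (k%:R - mu%:R) ->
  (p%:Z %| th - th')%Z -> th = th'.
Proof.
move=> p_pr co_ps e e' dth; apply/eqP; rewrite -subr_eq0; apply/negPn/negP => nz.
have sum_th : th + th' = lam%:R - mu%:R.
  apply/eqP; rewrite -subr_eq0 -(inj_eq (mulfI nz)) mulr0.
  have -> : (th - th') * (th + th' - (lam%:R - mu%:R)) =
    (th ^+ 2 - (lam%:R - mu%:R) * th) - (th' ^+ 2 - (lam%:R - mu%:R) * th') by ring.
  by rewrite e e'; apply/eqP; ring.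
have : (th - th') ^+ 2 = s%:Z ^+ 2.
  rewrite sqrt_Delta /PDS_Delta -!natz -sum_th.
  have : k%:R - mu%:R = th ^+ 2 - (lam%:R - mu%:R) * th by rewrite e; ring.
  by rewrite -sum_th => ->; ring.
move=> /(congr1 (fun z => (p%:Z %| z)%Z)).
rewrite dvdz_exp // !dvdzE abszX absz_nat Euclid_dvdX // andbT => /esym.
by move: co_ps; rewrite prime_coprime // => /negbTE ->.
Qed.

Lemma PDS_primepow_char p e (xi : 'CF(G)) a (th : int) :
  prime p -> coprime p s -> xi \is a linear_char -> xi ^+ (p ^ e) = 1 ->
  a \in G -> xi a != 1 -> \sum_(d in D) xi d = th%:~R ->
  (#|'C_G[a]%g| * #|((a ^: G) :&: D)%g|)%N%:Z = k%:Z - th.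
Proof.
move=> p_pr co_ps Lxi xi1 Ga xia1 Xth.
have nt_xi : xi != 1 by apply: contraNneq xia1 => ->; rewrite cfun1E Ga.
have a1 : a != 1%g by apply: contraNneq xia1 => ->; rewrite lin_char1.
have [th0 Xth0 quad] := PDS_lin_char_int Lxi nt_xi.
have {Xth0} eth : th0 = th by apply/eqP; rewrite -(eqr_int algC) -Xth0 Xth.
rewrite {th0}eth in quad.
set F := (_ * _)%N.
suff: F%:R - k%:R + th = 0 :> int by rewrite !natz => e0; lia.
apply: (eq_primepow_dvd0 p_pr) => n.
(* [k] is the value on [D] of the principal character, and [xi] has p-power order. *)
have dk : (p%:Z %| k%:Z - th)%Z.
  apply: (PDS_lin_char_congr (al := 1) (ze := xi) (e := e)) => //; rewrite ?mul1r //.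
    exact: cfun1_lin_char.
  have [[_ _ <- _] _ _] := pdsD; rewrite -pmulrn -sumr_const.
  by apply: eq_bigr => d /(subsetP sDG) Gd; rewrite cfun1E Gd.
(* The word count loses a factor p^e, so length p^(n+e) leaves divisibility by p^n. *)
pose q := (p ^ (n + e))%N.
have [be count diff] := PDS_card_class_words pdsD q Ga a1.
have dW : (p%:Z ^+ n %| #|class_words G D q a|%:R)%Z.
  have := dvdn_card_class_words sDG (n + e) p_pr Lxi xi1 Ga xia1.
  by rewrite addnK natz dvdzE abszX absz_nat.
(* If [p] divided [be], then th^q - th2^q = be (th - th2) and Fermat would give th = th2 modulo [p].
   The roots would coincide, so [s] would be 0, which is not coprime to [p]. *)
have co_be : coprimez (p%:Z ^+ n) be.
  rewrite coprimezE abszX coprimeXl // prime_coprime //; apply/negP => p_be.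
  pose th2 : int := lam%:R - mu%:R - th.
  have e1 : th + th2 = lam%:R - mu%:R by rewrite /th2; ring.
  have e2 : th * th2 = mu%:R - k%:R.
    have -> : th * th2 = (lam%:R - mu%:R) * th - th ^+ 2 by rewrite /th2; ring.
    by rewrite quad; ring.
  have quad2 : th2 ^+ 2 = (lam%:R - mu%:R) * th2 + (k%:R - mu%:R).
    by rewrite -e1 -[k%:R - _]opprB -e2; ring.
  have dth : (p%:Z %| th - th2)%Z.
    have -> : th - th2 = be * (th - th2) - (th ^+ q - th) + (th2 ^+ q - th2).
      by rewrite (diff _ _ e1 e2); ring.
    apply: rpredD; last exact: fermat_little_int.
    by apply: rpredB; [apply: dvdz_mulr | apply: fermat_little_int].
  have eth := PDS_roots_congr p_pr co_ps quad quad2 dth.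
  have : s%:Z ^+ 2 = 0.
    rewrite sqrt_Delta /PDS_Delta -!natz -e1 -[k%:R - _]opprB -e2 -eth; ring.
  move/eqP; rewrite expf_eq0 /= => /eqP[s0]; move: co_ps.
  by rewrite s0 /coprime gcdn0 gtn_eqF ?prime_gt1.
rewrite -(Gauss_dvdzr _ co_be).
have -> : be * (F%:R - k%:R + th) =
   (#|'C_G[a]%g| * #|class_words G D q a|)%N%:R - (k%:R ^+ q - th ^+ q).
  by rewrite (count _ quad) -/F; ring.
rewrite rpredB ?natrM ?dvdz_mull // natz.
apply: dvdz_trans (dvdz_sub_exp_primepow (n + e) dk).
by rewrite dvdz_exp2l // leqW ?leq_addr.
Qed.

End PDSLinearCharacters.

(** * Nonprincipal characters of [H] agree on [D] *)

Lemma exists_primepow_exp_neq1 (R : nzRingType) (z : R) n :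
  (0 < n)%N -> z ^+ n = 1 -> z != 1 ->
  exists2 p, p \in \pi(n) & z ^+ n`_p^' != 1.
Proof.
move=> n_gt0 zn1 z1; have [d prim_d d_n] := prim_order_exists n_gt0 zn1.
have d_gt0 := prim_order_gt0 prim_d.
have d_gt1 : (1 < d)%N.
  rewrite ltn_neqAle d_gt0 andbT; apply: contraNneq z1 => d1.
  by have := prim_expr_order prim_d; rewrite -d1 expr1 => ->.
have p_pr := pdiv_prime d_gt1; have p_d := pdiv_dvd d.
exists (pdiv d); first by rewrite mem_primes p_pr n_gt0 (dvdn_trans p_d).
(* The p'-part of [n] is prime to [p], hence no multiple of the exact order [d] of [z]. *)
have := part_pnat (pdiv d)^' n; rewrite p'natE //.
by apply: contraNneq => /eqP; rewrite -(prim_order_dvd prim_d) => /(dvdn_trans p_d).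
Qed.

Section PDSLinearCharacterGroup.
Variables (gT : finGroupType) (G : {group gT}) (D : {set gT}).
Variables (v k lam mu s : nat) (K : 'CF(G) -> Prop).
Hypothesis pdsD : is_regular_PDS G D v k lam mu.
Hypothesis sqrt_Delta : (s%:Z ^+ 2)%R = PDS_Delta k lam mu.
Hypothesis linK : forall xi, K xi -> xi \is a linear_char.
Hypothesis K1 : K 1.
Hypothesis KM : forall xi eta, K xi -> K eta -> K (xi * eta).
Hypothesis coK : forall xi, K xi -> coprime #[xi]%CF s.

Lemma lin_group_exp xi n : K xi -> K (xi ^+ n).
Proof. by move=> Kxi; elim: n => // n IHn; rewrite exprS; apply: KM. Qed.

Lemma coprime_pi_cforder xi p : K xi -> p \in \pi(#[xi]%CF) -> coprime p s.
Proof.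
by move=> Kxi; rewrite mem_primes => /and3P[_ _ /coprime_dvdl]; apply; apply: coK.
Qed.

Lemma PDS_sum_mul_primepow p e (xi ze : 'CF(G)) :
  prime p -> coprime p s -> K xi -> K ze -> ze ^+ (p ^ e) = 1 ->
  xi != 1 -> xi * ze != 1 -> \sum_(d in D) (xi * ze) d = \sum_(d in D) xi d.
Proof.
move=> p_pr co_ps Kxi Kze ze1 nt_xi nt_xize.
have [th Xth quad] := PDS_lin_char_int pdsD sqrt_Delta (linK Kxi) nt_xi.
have [th' Xth' quad'] := PDS_lin_char_int pdsD sqrt_Delta (linK (KM Kxi Kze)) nt_xize.
have dth := PDS_lin_char_congr pdsD p_pr (linK Kxi) (linK Kze) ze1 Xth Xth'.
by rewrite Xth Xth' (PDS_roots_congr sqrt_Delta p_pr co_ps quad quad' dth).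
Qed.

Lemma PDS_sum_eq_primepow p e r f (xi eta : 'CF(G)) :
  prime p -> coprime p s -> prime r -> coprime r s -> K xi -> K eta ->
  xi ^+ (r ^ f) = 1 -> eta ^+ (p ^ e) = 1 -> xi != 1 -> eta != 1 ->
  \sum_(d in D) xi d = \sum_(d in D) eta d.
Proof.
move=> p_pr co_ps r_pr co_rs Kxi Keta xi1 eta1 nt_xi nt_eta.
(* [xi] and [eta] are both linked to [xi * eta], unless the latter is trivial. *)
have [xieta1|nt_xieta] := eqVneq (xi * eta) 1; last first.
  rewrite -(PDS_sum_mul_primepow p_pr co_ps Kxi Keta eta1) // [xi * eta]mulrC.
  by rewrite (PDS_sum_mul_primepow r_pr co_rs Keta Kxi xi1) // mulrC.
(* When [xi] is the inverse of [eta], the link is direct: [eta] is [xi] times the p-element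
   [eta * eta], and both ends are nonprincipal. *)
have -> : eta = xi * (eta * eta) by rewrite mulrA xieta1 mul1r.
rewrite (PDS_sum_mul_primepow (e := e) p_pr co_ps) //; first exact: KM.
  by rewrite exprMn eta1 mulr1.
by rewrite mulrA xieta1 mul1r.
Qed.

(** Strong induction on the order of [xi]: unless that order is a power of a prime [r], dropping the
    r-part of [xi] keeps the value on [D] and lowers the order. *)
Lemma PDS_sum_eq p e (xi eta : 'CF(G)) :
  prime p -> coprime p s -> K xi -> K eta -> eta ^+ (p ^ e) = 1 ->
  xi != 1 -> eta != 1 -> \sum_(d in D) xi d = \sum_(d in D) eta d.
Proof.
move=> p_pr co_ps Kxi Keta eta1 nt_xi nt_eta.
have [n le_n] := ubnP #[xi]%CF; elim: n => // n IHn in xi Kxi nt_xi le_n *.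
set o := #[xi]%CF in le_n; have o_gt0 : (0 < o)%N := cforder_lin_char_gt0 (linK Kxi).
have xio : xi ^+ o = 1 := exp_cforder xi.
have o_gt1 : (1 < o)%N.
  by rewrite ltn_neqAle o_gt0 andbT eq_sym -dvdn1 dvdn_cforder.
pose r := pdiv o; have r_pr : prime r := pdiv_prime o_gt1.
have co_rs : coprime r s.
  by apply: (coprime_pi_cforder Kxi); rewrite mem_primes r_pr o_gt0 pdiv_dvd.
have [xi_r|xi_r] := eqVneq (xi ^+ o`_r) 1.
  rewrite p_part in xi_r.
  exact: PDS_sum_eq_primepow p_pr co_ps r_pr co_rs Kxi Keta xi_r eta1 nt_xi nt_eta.
have co_o : coprime o`_r o`_r^' := coprime_partC _ _ _.
have oE : (o`_r * o`_r^' = o)%N by rewrite partnC.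
(* [xi ^+ M.+1] is the r'-part of [xi], and [xi ^+ M] has r-power order. *)
pose M := chinese o`_r o`_r^' (o`_r).-1 0.
have M0 : (o`_r^' %| M)%N by rewrite /dvdn chinese_modr // mod0n.
have M1 : (o`_r %| M.+1)%N.
  rewrite /dvdn -addn1 -modnDml chinese_modl // modnDml addn1 prednK ?part_gt0 //.
  by rewrite modnn.
(* Otherwise the r'-part of [o] divides both [M] and [M.+1], so it is 1 and [xi] has r-power
   order. *)
have nt_xiM : xi ^+ M.+1 != 1.
  apply: contra xi_r; rewrite -!dvdn_cforder -/o => o_M.
  have := dvdn_trans (dvdn_part r^' o) o_M.
  rewrite -addn1 dvdn_addr // dvdn1 => /eqP o1.
  by rewrite -{1}oE o1 muln1.
rewrite -(PDS_sum_mul_primepow (e := logn r o) (ze := xi ^+ M) r_pr co_rs) -?exprS //.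
- apply: IHn => //; first exact: lin_group_exp.
  rewrite -ltnS; apply: leq_trans le_n; rewrite ltnS.
  apply: (@leq_ltn_trans o`_r^').
    apply: dvdn_leq; first exact: part_gt0.
    by rewrite dvdn_cforder -exprM -dvdn_cforder -/o -{1}oE dvdn_mul.
  rewrite -[X in (_ < X)%N]oE ltn_Pmull ?part_gt0 // p_part.
  rewrite -[X in (X < _)%N](expn0 r) ltn_exp2l ?prime_gt1 //.
  by rewrite logn_gt0 mem_primes r_pr o_gt0 pdiv_dvd.
- exact: lin_group_exp.
- by apply/eqP; rewrite -p_part -exprM -dvdn_cforder -/o -{1}oE mulnC dvdn_mul.
Qed.

End PDSLinearCharacterGroup.

(** * From one character of prime power order to all of [H] *)

Theorem mainTheorem9 (gT : finGroupType) (G : {group gT}) (D : {set gT})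
    (v k lam mu : nat) (s : nat) (H : {set Iirr G}) :
  is_regular_PDS G D v k lam mu ->
  (0 < mu)%N -> (mu < k)%N ->
  (s%:Z ^+ 2)%R = PDS_Delta k lam mu ->
  is_lin_char_subgroup H ->
  (exists2 i, i \in H & i != 0) ->
  (forall i, i \in H -> coprime #['chi_i]%CF s) ->
  let N := \bigcap_(i in H) cfker 'chi_i in
  forall a, a \in (G :\: N)%g ->
  forall i, i \in H -> i != 0 ->
    (#|'C_G[a]%g| * #|((a ^: G) :&: D)%g|)%N%:R = k%:R - (\sum_(d in D) 'chi_i d) :> algC.
Proof.
move=> pdsD _ _ sqrtD [linH H0 HM _] _ coH N a; rewrite inE => /andP[N'a Ga] i Hi nt_i.
(* Membership in [H] becomes a predicate on class functions, so that products and powers need no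
   index. *)
pose K (xi : 'CF(G)) := exists2 j, j \in H & 'chi_j = xi.
have linK xi : K xi -> xi \is a linear_char by case=> j Hj <-; apply: linH.
have coK xi : K xi -> coprime #[xi]%CF s by case=> j Hj <-; apply: coH.
have K1 : K 1 by exists 0; rewrite ?irr0.
have KM xi eta : K xi -> K eta -> K (xi * eta).
  by case=> j Hj <- [l Hl <-]; apply: HM.
(* The given character ['chi_i] may be trivial at [a]. Some ['chi_j] is not, and neither is a
   suitable power [eta] of it, of p-power order; [eta] then replaces ['chi_i], having the same value
   on [D]. *)
have [j Hj ja] : exists2 j, j \in H & 'chi_j a != 1.
  apply/exists_inP; apply: contraNT N'a => /exists_inPn ja1.
  apply/bigcapP => j Hj; have := ja1 j Hj; rewrite negbK => /eqP ja.
  by rewrite cfkerEchar ?irr_char // inE Ga ja lin_char1 ?linH //=.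
have Kj : K 'chi_j by exists j.
have jo : 'chi_j a ^+ #['chi_j]%CF = 1 by rewrite -exp_cfunE // exp_cforder cfun1E Ga.
have o_gt0 := cforder_lin_char_gt0 (linH j Hj).
have [p p_o eta_a] := exists_primepow_exp_neq1 o_gt0 jo ja.
have co_ps := coprime_pi_cforder coK Kj p_o.
have p_pr : prime p by move: p_o; rewrite mem_primes => /andP[].
pose eta := 'chi_j ^+ (#['chi_j]%CF)`_p^'.
have Keta : K eta by apply: lin_group_exp.
have eta1 : eta ^+ (p ^ logn p #['chi_j]%CF) = 1.
  by rewrite -exprM -p_part mulnC partnC // exp_cforder.
rewrite -exp_cfunE // -/eta in eta_a.
have nt_eta : eta != 1 by apply: contraNneq eta_a => ->; rewrite cfun1E Ga.
have Ki : K 'chi_i by exists i.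
rewrite (PDS_sum_eq pdsD sqrtD linK K1 KM coK p_pr co_ps Ki Keta eta1) ?irr_eq1 //.
have [th Xth _] := PDS_lin_char_int pdsD sqrtD (linK _ Keta) nt_eta.
rewrite Xth -[k%:R]/((k%:Z)%:~R) -rmorphB -[X in X = _]/((_%:Z)%:~R) /=.
by rewrite (PDS_primepow_char pdsD sqrtD p_pr co_ps (linK _ Keta) eta1 Ga eta_a Xth).
Qed.
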